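(* Let $n\ge5$ and let $(a_{ij})_{i,j=1}^n$ be a real array with $a_{ij}=a_{ji}$ for all $i,j$. Define $a_{io}=\frac{1}{n-2}\sum_{j\ne i}a_{ij}$, $a_{oo}=\frac{1}{(n-1)(n-2)}\sum_{i\ne j}a_{ij}$, $\mu=(n-2)a_{oo}$, $a_o=\max_{i\ne j}|a_{ij}-2a_{io}+a_{oo}|$ and $S=\sum_{i\ne j}(a_{ij}-2a_{io}+a_{oo})^2$, and let $Y=\sum_{i=1}^n a_{i\pi(i)}$ for a random permutation $\pi$ of $\{1,\dots,n\}$. (i) If $n$ is even and $\pi$ is uniformly distributed over the set of fixed point free involutions of $\{1,\ldots,n\}$, set $\sigma^2=\frac{2(n-2)}{(n-1)(n-3)}S$ and $c=24a_o$. (ii) If the distribution of $\pi$ is constant on cycle type (i.e. $\mathbb{P}(\pi=\tau)=\mathbb{P}(\pi=\tau')$ whenever $\tau,\tau'$ have the same number of $q$-cycles for every $q$) and with probability one $\pi$ has no fixed points and no $2$-cycles, set $\sigma^2=\frac{1}{n-1}S$ and $c=40a_o$. In either case, assuming $\sigma^2>0$, $\mathbb{E}[Y]=\mu$, and for every $t\ge0$ $$\max\{\mathbb{P}(Y-\mu\ge t),\mathbb{P}(Y-\mu\le -t)\}\le \exp\left(-\frac{t^2}{2(\sigma^2+ct)}\right)\quad\text{and}\quad \max\{\mathbb{P}(Y-\mu\ge t),\mathbb{P}(Y-\mu\le -t)\}\le \exp\left(-\frac{t^2}{10\sigma^2/3+ct}\right),$$ and for every $t>e$ $$\max\{\mathbb{P}(Y-\mu\ge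 t),\mathbb{P}(Y-\mu\le -t)\}\le \exp\left(-\frac{t}{c}\left(\log t-\log\log t-\frac{\sigma^2}{c}\right)\right)\le\exp\left(-\frac{t}{2c}\left(\log t-\frac{2\sigma^2}{c}\right)\right).$$
   Context: A fixed point free involution is a permutation $\tau$ with $\tau(\tau(i))=i$ and $\tau(i)\neq i$ for all $i$. The cycle type of a permutation $\tau\in S_n$ is the vector $(f_1(\tau),\dots,f_n(\tau))$ where $f_q(\tau)$ is the number of cycles of length $q$ in $\tau$. *)

(* Defs.v *)
From Stdlib Require Import Reals.
From mathcomp Require Import all_boot all_fingroup.

Set Implicit Arguments.
Unset Strict Implicit.
Unset Printing Implicit Defensive.

Local Open Scope R_scope.

Definition Rsum (T : finType) (f : T -> R) : R :=
  foldr (fun x acc => f x + acc) 0 (enum T).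

Section Defs.
Variable n : nat.
Variable a : 'I_n -> 'I_n -> R.

Definition a_io (i : 'I_n) : R :=
  / (INR n - 2) * Rsum (fun j : 'I_n => if j != i then a i j else 0).

Definition a_oo : R :=
  / ((INR n - 1) * (INR n - 2)) *
  Rsum (fun i : 'I_n => Rsum (fun j : 'I_n => if i != j then a i j else 0)).

Definition mu : R := (INR n - 2) * a_oo.

Definition a_cent (i j : 'I_n) : R := a i j - 2 * a_io i + a_oo.

Definition a_o : R :=
  foldr Rmax 0 [seq Rabs (a_cent p.1 p.2) | p <- enum [pred p : 'I_n * 'I_n | p.1 != p.2]].

Definition S_sum : R :=
  Rsum (fun i : 'I_n => Rsum (fun j : 'I_n => if i != j then (a_cent i j) ^ 2 else 0)).

Definition Yval (tau : {perm 'I_n}) : R := Rsum (fun i : 'I_n => a i (tau i)).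

End Defs.

Definition is_distribution (n : nat) (p : {perm 'I_n} -> R) : Prop :=
  (forall tau, 0 <= p tau) /\ Rsum p = 1.

Definition Prob (n : nat) (p : {perm 'I_n} -> R) (E : {perm 'I_n} -> Prop)
  (dec : forall tau, {E tau} + {~ E tau}) : R :=
  Rsum (fun tau => if dec tau then p tau else 0).

Definition Expect (n : nat) (p : {perm 'I_n} -> R) (X : {perm 'I_n} -> R) : R :=
  Rsum (fun tau => p tau * X tau).

Definition P_upper n (a : 'I_n -> 'I_n -> R) (p : {perm 'I_n} -> R) (t : R) : R :=
  Prob p (fun tau => Rle_dec t (Yval a tau - mu a)).
Definition P_lower n (a : 'I_n -> 'I_n -> R) (p : {perm 'I_n} -> R) (t : R) : R :=
  Prob p (fun tau => Rle_dec (Yval a tau - mu a) (- t)).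

Definition fpf_involution n (tau : {perm 'I_n}) : bool :=
  [forall i, (tau (tau i) == i) && (tau i != i)].

Definition ncycles n (tau : {perm 'I_n}) (q : nat) : nat :=
  #|[set C in porbits tau | #|C| == q]|.

Definition same_cycle_type n (tau tau' : {perm 'I_n}) : Prop :=
  forall q : nat, ncycles tau q = ncycles tau' q.

Definition no_fix_no_2cycle n (tau : {perm 'I_n}) : Prop :=
  forall i : 'I_n, tau i <> i /\ tau (tau i) <> i.

Definition uniform_fpf_involution n (p : {perm 'I_n} -> R) : Prop :=
  forall tau, p tau =
    if fpf_involution tau
    then / Rsum (fun s : {perm 'I_n} => if fpf_involution s then 1 else 0)
    else 0.

Definition cycle_type_constant_no_fix_no_2 n (p : {perm 'I_n} -> R) : Prop :=
  (forall tau tau', same_cycle_type tau tau' -> p tau = p tau') /\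
  (forall tau, p tau <> 0 -> no_fix_no_2cycle tau).

(* Main.v *)
(** Replace [a] by [b i j = a i j - a_io i - a_io j + a_oo] with zero diagonal: [b] is symmetric
with zero row sums, [Y - mu] is the sum of the [b i (pi i)], and averaging
[a_cent i j] with [a_cent j i] gives [|b| <= a_o] and [sum b^2 <= S_sum].
Both laws are invariant under conjugation, so [pi] may be taken to be [tau ^ s] with [tau] fixed
and [s] uniform over all permutations; then [Y - mu] is [sum_m b (s m) (s (tau m))].
Precomposing [s] with a random transposition [(k l)] gives an exchangeable pair [(Y', Y'')] with
linear regression, whence [E (Y f(Y))] is a multiple of [E ((Y' - Y'') (f(Y') - f(Y'')))].
For [f = exp (theta .)] convexity bounds this by [theta E ((Y' - Y'')^2 f(Y'))].
The difference [Y' - Y''] depends only on the values of [s] at [k], [l] and their neighbours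
under [tau].  Forcing these values by transpositions changes at most 12 (involutions), respectively
20, of the summands of [Y], so the two factors decouple at the cost of [exp (c theta)], with
[c = 24 a_o], respectively [40 a_o].  This is the zero bias inequality
[E (Y exp (theta Y)) <= sigma^2 theta exp (c theta) E (exp (theta Y))]; integrating it bounds
the Laplace transform, and all three tail bounds are Chernoff bounds. *)
Require Import Defs.
From Stdlib Require Import Reals Lra.
From mathcomp Require Import all_boot all_fingroup.
From Coquelicot Require Import Coquelicot.
Set Implicit Arguments.
Unset Strict Implicit.
Unset Printing Implicit Defensive.

(** * Laplace transforms and tails *)

Section Analysis.
Local Open Scope R_scope.

(** * Inequalities for the exponential *)

Lemma nonneg_derivative_mono (f f' : R -> R) (x : R) :
  (forall y, derivable_pt_lim f y (f' y)) -> (forall y, 0 <= y -> 0 <= f' y) ->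
  0 <= x -> f 0 <= f x.
Proof.
move=> df f'0 [x0|<-]; last exact: Rle_refl.
have [|y [Ey [y0 _]]] := MVT_cor2 f f' 0 x x0; first by move=> y _; apply: df.
have := f'0 y (Rlt_le _ _ y0); nra.
Qed.

Lemma exp_mono (x y : R) : x <= y -> exp x <= exp y.
Proof.
by case/Rle_lt_or_eq_dec => [/exp_increasing/Rlt_le|->]; [|exact: Rle_refl].
Qed.

Lemma exp_one_minus (y : R) : (1 - y) * exp y <= 1.
Proof.
have := exp_ineq1_le (- y); rewrite exp_Ropp; have e0 := exp_pos y => H1.
have : (1 - y) * exp y <= / exp y * exp y by apply: Rmult_le_compat_r; lra.
by rewrite Rinv_l; lra.
Qed.

(** Equivalent to [tanh (u / 2) <= u / 2]. The difference of the two sides vanishes at 0 and has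
    derivative [1 - (1 - u) * exp u], nonnegative by [exp_one_minus]. *)
Lemma exp_pade (u : R) : 0 <= u -> (2 - u) * exp u <= 2 + u.
Proof.
move=> u0; have := @nonneg_derivative_mono
  (fun u => 2 + u - (2 - u) * exp u) (fun u => 1 - (1 - u) * exp u) u.
rewrite exp_0 => H; suff : 0 <= 2 + u - (2 - u) * exp u by lra.
apply: Rle_trans (H _ _ u0); first lra.
  move=> y; apply/is_derive_Reals.
  by auto_derive => //; ring.
by move=> y _; have := exp_one_minus y; lra.
Qed.

(** The factor [exp u * (u - 1) + 1] is the integral of [x * exp x] from 0 to [u], the numerator of
    [mgf_exponent]. The derivative of the difference factors as
    [(1 + u) * (1 - (1 - u) * exp u)]. *)
Lemma exp_bernstein (u : R) : 0 <= u ->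
  (1 - u) * (exp u * (u - 1) + 1) <= u ^ 2 / 2.
Proof.
move=> u0; have := @nonneg_derivative_mono
  (fun u => u ^ 2 / 2 - (1 - u) * (exp u * (u - 1) + 1))
  (fun u => (1 + u) * (1 - (1 - u) * exp u)) u.
rewrite exp_0 => H.
suff : 0 <= u ^ 2 / 2 - (1 - u) * (exp u * (u - 1) + 1) by lra.
apply: Rle_trans (H _ _ u0); first lra.
  by move=> y; apply/is_derive_Reals; auto_derive => //; field.
by move=> y y0; have := exp_one_minus y; nra.
Qed.

Lemma exp_bernstein' (u : R) : 0 <= u ->
  (2 - u) * (exp u * (u - 1) + 1) <= 5 / 3 * u ^ 2.
Proof.
move=> u0; have := @nonneg_derivative_mono
  (fun u => 5 / 3 * u ^ 2 - (2 - u) * (exp u * (u - 1) + 1))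
  (fun u => 10 / 3 * u + 1 - exp u * (1 + u - u ^ 2)) u.
rewrite exp_0 => H.
suff : 0 <= 5 / 3 * u ^ 2 - (2 - u) * (exp u * (u - 1) + 1) by lra.
apply: Rle_trans (H _ _ u0); first lra.
  by move=> y; apply/is_derive_Reals; auto_derive => //; field.
move=> y y0; have e0 := exp_pos y; have P := exp_pade y0.
case: (Rle_or_lt (1 + y - y ^ 2) 0) => [neg|pos]; first nra.
have y2 : 0 < 2 - y by nra.
have : 0 <= (1 + y - y ^ 2) * (2 + y - (2 - y) * exp y).
  by apply: Rmult_le_pos; lra.
(* Multiplying the goal by [2 - y] and bounding [(2 - y) * exp y] by [exp_pade] leaves this cubic;
   its quadratic factor has negative discriminant. *)
have : 0 <= y * (8 / 3 - 7 / 3 * y + y ^ 2) by apply: Rmult_le_pos; nra.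
move=> A B; suff : 0 <= (2 - y) * (10 / 3 * y + 1 - exp y * (1 + y - y ^ 2)).
  by move=> D; apply: (Rmult_le_reg_l (2 - y)); lra.
lra.
Qed.

(** By convexity the mean of [exp] over an interval is at most the average of its endpoint values.
    With [exp (theta * y)] factored out this is [exp_pade] at [theta * (x - y)]. *)
Lemma exp_slope_le (theta x y : R) : 0 <= theta ->
  (exp (theta * x) - exp (theta * y)) * (x - y)
    <= theta * ((x - y) ^ 2 * ((exp (theta * x) + exp (theta * y)) / 2)).
Proof.
move=> th0.
wlog xy : x y / y <= x => [H|].
  by case: (Rle_or_lt y x) => [|/Rlt_le] /H; lra.
have u0 : 0 <= theta * (x - y) by apply: Rmult_le_pos; lra.
have P := exp_pade u0; have e0 := exp_pos (theta * y).
have -> : theta * x = theta * y + theta * (x - y) by ring.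
rewrite exp_plus; set e := exp (theta * y) in e0 *.
set E := exp (theta * (x - y)) in P *.
have Q : 0 <= e * (x - y) * (2 + theta * (x - y) - (2 - theta * (x - y)) * E).
  by apply: Rmult_le_pos; [apply: Rmult_le_pos|]; lra.
lra.
Qed.

(** * Finite sums *)

Lemma Rsum_ext (T : finType) (f g : T -> R) : (forall x, f x = g x) -> Rsum f = Rsum g.
Proof. by move=> fg; rewrite /Rsum; elim: (enum T) => //= x s ->; rewrite fg. Qed.

Lemma Rsum_le (T : finType) (f g : T -> R) : (forall x, f x <= g x) -> Rsum f <= Rsum g.
Proof.
move=> fg; rewrite /Rsum; elim: (enum T) => [|x s IH] /=; first exact: Rle_refl.
exact: Rplus_le_compat.
Qed.

Lemma Rsum_scal (T : finType) (a : R) (f : T -> R) : Rsum (fun x => a * f x) = a * Rsum f.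
Proof. by rewrite /Rsum; elim: (enum T) => [|x s IH] /=; [ring | rewrite IH; ring]. Qed.

Lemma derivable_pt_lim_Rsum (T : finType) (f f' : T -> R -> R) (y : R) :
  (forall x, derivable_pt_lim (f x) y (f' x y)) ->
  derivable_pt_lim (fun z => Rsum (fun x => f x z)) y (Rsum (fun x => f' x y)).
Proof.
move=> df; rewrite /Rsum; elim: (enum T) => [|x s IH] /=.
  exact: derivable_pt_lim_const.
exact: (derivable_pt_lim_plus _ _ _ _ _ (df x) IH).
Qed.

(* [(exp (c x) (c x - 1) + 1) / c^2] is the primitive of [x exp (c x)] vanishing at 0. *)
Definition mgf_exponent (c x : R) : R := (exp (c * x) * (c * x - 1) + 1) / c ^ 2.

(** * Tail bounds from the zero bias inequality *)

Section Tail.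
Variables (T : finType) (p Z : T -> R) (sigma2 c : R).
Hypothesis p0 : forall x, 0 <= p x.
Hypothesis p1 : Rsum p = 1.
Hypothesis c0 : 0 < c.
Hypothesis s0 : 0 < sigma2.

Let M (theta : R) : R := Rsum (fun x => p x * exp (theta * Z x)).

Hypothesis zero_bias : forall theta, 0 <= theta ->
  Rsum (fun x => p x * (Z x * exp (theta * Z x))) <= sigma2 * theta * exp (c * theta) * M theta.

(** Gronwall: [zero_bias] bounds [M'] by [K' * M] with [K = sigma2 * mgf_exponent c], so
    [M * exp (- K)] is nonincreasing from its value 1 at 0. *)
Lemma mgf_le theta : 0 <= theta -> M theta <= exp (sigma2 * mgf_exponent c theta).
Proof.
move=> th0; pose K x := sigma2 * mgf_exponent c x.
have dK y : derivable_pt_lim (fun x => exp (- K x)) y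
    (- (sigma2 * y * exp (c * y)) * exp (- K y)).
  apply/is_derive_Reals; rewrite /K /mgf_exponent.
  auto_derive => //; congr (_ * exp (- _)); field; lra.
have dM y : derivable_pt_lim M y (Rsum (fun x => p x * (Z x * exp (y * Z x)))).
  apply: (@derivable_pt_lim_Rsum _ (fun x z => p x * exp (z * Z x))
           (fun x z => p x * (Z x * exp (z * Z x)))) => x.
  apply/is_derive_Reals.
  by auto_derive => //; ring.
have := @nonneg_derivative_mono (fun x => - (M x * exp (- K x))) _ theta
  (fun y => derivable_pt_lim_opp _ _ _ (derivable_pt_lim_mult _ _ _ _ _ (dM y) (dK y))).
have M0 : M 0 = 1.
  by rewrite -p1; apply: Rsum_ext => x; rewrite Rmult_0_l exp_0 Rmult_1_r.
have K0 : K 0 = 0 by rewrite /K /mgf_exponent Rmult_0_r exp_0; field; lra.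
rewrite M0 K0 Ropp_0 exp_0 => H.
have {}H : M theta * exp (- K theta) <= 1.
  suff : - (1 * 1) <= - (M theta * exp (- K theta)) by lra.
  apply: H th0 => y y0; have zb := zero_bias y0.
  have eK := exp_pos (- K y).
  have : 0 <= (sigma2 * y * exp (c * y) * M y
    - Rsum (fun x => p x * (Z x * exp (y * Z x)))) * exp (- K y).
    by apply: Rmult_le_pos; lra.
  lra.
rewrite exp_Ropp in H; have eK := exp_pos (K theta).
have : M theta * / exp (K theta) * exp (K theta) <= 1 * exp (K theta).
  by apply: Rmult_le_compat_r; lra.
rewrite Rmult_assoc Rinv_l; last lra.
by rewrite /K; lra.
Qed.

Lemma chernoff t theta : 0 <= theta ->
  Rsum (fun x => if Rle_dec t (Z x) then p x else 0)
    <= exp (sigma2 * mgf_exponent c theta - theta * t).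
Proof.
move=> th0; rewrite /Rminus exp_plus Rmult_comm.
apply: (Rle_trans _ (exp (- (theta * t)) * M theta)); last first.
  by apply: Rmult_le_compat_l; [apply/Rlt_le/exp_pos | apply: mgf_le].
rewrite /M -Rsum_scal; apply: Rsum_le => x.
have e0 := exp_pos (theta * Z x); have e1 := exp_pos (- (theta * t)).
case: (Rle_dec t (Z x)) => [tZ|ntZ] /=; last first.
  by apply: Rmult_le_pos; [lra | apply: Rmult_le_pos; [apply: p0 | lra]].
have -> : exp (- (theta * t)) * (p x * exp (theta * Z x)) = p x * exp (theta * (Z x - t)).
  rewrite Rmult_minus_distr_l /Rminus exp_plus; ring.
rewrite -{1}(Rmult_1_r (p x)); apply: Rmult_le_compat_l => //.
have := exp_ineq1_le (theta * (Z x - t)).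
have : 0 <= theta * (Z x - t) by apply: Rmult_le_pos; lra.
lra.
Qed.

Lemma tail_bernstein t : 0 <= t ->
  Rsum (fun x => if Rle_dec t (Z x) then p x else 0)
    <= exp (- (t ^ 2 / (2 * (sigma2 + c * t)))).
Proof.
move=> t0; have d0 : 0 < sigma2 + c * t by nra.
(* This choice keeps [c * theta < 1], and [exp_bernstein] then bounds the first part of the exponent
   by [theta * t / 2], half of what is subtracted. *)
set theta := t / (sigma2 + c * t).
have th0 : 0 <= theta by apply: Rdiv_le_0_compat.
apply: Rle_trans (chernoff t th0) _; apply: exp_mono.
have u0 : 0 <= c * theta by nra.
have B := exp_bernstein u0; set G := exp _ * _ + 1 in B.
have Eu : 1 - c * theta = sigma2 / (sigma2 + c * t) by rewrite /theta; field; lra.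
rewrite /mgf_exponent -/G.
have <- : sigma2 / c ^ 2 * ((sigma2 + c * t) / sigma2 * (c * theta) ^ 2 / 2) - theta * t
    = - (t ^ 2 / (2 * (sigma2 + c * t))) by rewrite /theta; field; repeat split; lra.
apply: Rplus_le_compat_r.
have -> : sigma2 * (G / c ^ 2) = sigma2 / c ^ 2 * G by field; lra.
apply: Rmult_le_compat_l; first by apply: Rdiv_le_0_compat; nra.
apply: (Rmult_le_reg_l (1 - c * theta)); first by rewrite Eu; apply: Rdiv_lt_0_compat.
apply: Rle_trans B _; rewrite Eu; apply: Req_le; field; lra.
Qed.

Lemma tail_bernstein' t : 0 <= t ->
  Rsum (fun x => if Rle_dec t (Z x) then p x else 0)
    <= exp (- (t ^ 2 / (10 * sigma2 / 3 + c * t))).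
Proof.
move=> t0; have d0 : 0 < 10 * sigma2 / 3 + c * t by nra.
(* Same balance as for the first bound, now with [c * theta < 2]: [exp_bernstein'] bounds the first
   part of the exponent by [theta * t / 2]. *)
set theta := 2 * t / (10 * sigma2 / 3 + c * t).
have th0 : 0 <= theta by apply: Rdiv_le_0_compat => //; lra.
apply: Rle_trans (chernoff t th0) _; apply: exp_mono.
have u0 : 0 <= c * theta by nra.
have B := exp_bernstein' u0; set G := exp _ * _ + 1 in B.
have Eu : 2 - c * theta = 20 * sigma2 / 3 / (10 * sigma2 / 3 + c * t).
  by rewrite /theta; field; lra.
rewrite /mgf_exponent -/G.
have <- : sigma2 / c ^ 2 * ((10 * sigma2 / 3 + c * t) / (4 * sigma2) * (c * theta) ^ 2) - theta * t
    = - (t ^ 2 / (10 * sigma2 / 3 + c * t)) by rewrite /theta; field; repeat split; lra.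
apply: Rplus_le_compat_r.
have -> : sigma2 * (G / c ^ 2) = sigma2 / c ^ 2 * G by field; lra.
apply: Rmult_le_compat_l; first by apply: Rdiv_le_0_compat; nra.
apply: (Rmult_le_reg_l (2 - c * theta)).
  by rewrite Eu; apply: Rdiv_lt_0_compat; lra.
apply: Rle_trans B _; rewrite Eu; apply: Req_le; field; lra.
Qed.

(** With [L = ln t] the claim is [L <= exp (L / 2)], which follows from [exp (L / 4) >= 1 + L / 4]
    squared and [(1 + L / 4)^2 >= L]. *)
Lemma ln_ln_le t : exp 1 < t -> ln (ln t) <= ln t / 2.
Proof.
move=> te; have L1 : 1 < ln t.
  by rewrite -(ln_exp 1); apply: ln_increasing => //; apply: exp_pos.
set L := ln t in L1 *; apply: Rnot_lt_le => /exp_increasing.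
rewrite exp_ln; last lra.
have -> : L / 2 = L / 4 + L / 4 by field.
rewrite exp_plus; have := exp_ineq1_le (L / 4) => H.
have : (1 + L / 4) * (1 + L / 4) <= exp (L / 4) * exp (L / 4).
  by apply: Rmult_le_compat; lra.
by have := pow2_ge_0 (L / 4 - 1); lra.
Qed.

Lemma tail_poisson t : exp 1 < t ->
  Rsum (fun x => if Rle_dec t (Z x) then p x else 0)
    <= exp (- (t / c * (ln t - ln (ln t) - sigma2 / c))).
Proof.
move=> te; have L1 : 1 < ln t.
  by rewrite -(ln_exp 1); apply: ln_increasing => //; apply: exp_pos.
have t0 : 0 < t by apply: Rlt_trans te; apply: exp_pos.
have lnL := ln_ln_le te; have ll0 : 0 < ln (ln t) by rewrite -ln_1; apply: ln_increasing; lra.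
(* Chosen so that [exp (c * theta) = t / ln t]. *)
set theta := (ln t - ln (ln t)) / c.
have th0 : 0 <= theta by apply: Rdiv_le_0_compat; lra.
apply: Rle_trans (chernoff t th0) _; apply: exp_mono.
have Eu : c * theta = ln t - ln (ln t) by rewrite /theta; field; lra.
have u0 : 0 <= c * theta by lra.
have Ee : exp (c * theta) = t / ln t.
  by rewrite Eu /Rminus exp_plus exp_Ropp !exp_ln //; lra.
(* With [u = c * theta], the numerator is at most [u * exp u], which equals
   [t * (ln t - ln (ln t)) / ln t] and is at most [t] because [ln (ln t) > 0]. *)
have K : mgf_exponent c theta <= t / c ^ 2.
  rewrite /mgf_exponent; apply: Rmult_le_compat_r; first by apply/Rlt_le/Rinv_0_lt_compat; nra.
  have e1 := exp_ineq1_le (c * theta).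
  apply: (Rle_trans _ (c * theta * exp (c * theta))); first lra.
  rewrite Ee Eu; apply: (Rmult_le_reg_r (ln t)); first lra.
  have -> : (ln t - ln (ln t)) * (t / ln t) * ln t = t * (ln t - ln (ln t)) by field; lra.
  by apply: Rmult_le_compat_l; lra.
apply: (Rle_trans _ (sigma2 * (t / c ^ 2) - theta * t)).
  by apply: Rplus_le_compat_r; apply: Rmult_le_compat_l; lra.
by apply: Req_le; rewrite /theta; field; lra.
Qed.

Lemma poisson_exponent_le t : exp 1 < t ->
  exp (- (t / c * (ln t - ln (ln t) - sigma2 / c)))
    <= exp (- (t / (2 * c) * (ln t - 2 * sigma2 / c))).
Proof.
move=> te; have lnL := ln_ln_le te; apply: exp_mono; apply: Ropp_le_contravar.
have t0 : 0 < t by apply: Rlt_trans te; apply: exp_pos.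
have -> : t / (2 * c) * (ln t - 2 * sigma2 / c) = t / c * (ln t / 2 - sigma2 / c) by field; lra.
by apply: Rmult_le_compat_l; [apply/Rlt_le/Rdiv_lt_0_compat|lra].
Qed.

End Tail.
End Analysis.

From mathcomp Require Import all_order all_algebra ring lra Rstruct.
Import Order.TTheory GRing.Theory Num.Theory.
Local Open Scope ring_scope.

(** * Exchangeable pair and decoupling for uniform permutations *)

Section Core.
Variables (R : realFieldType) (n : nat).

(** * Centered arrays and the exchangeable pair *)

Definition centered (b : 'I_n -> 'I_n -> R) :=
  [/\ forall x y, b x y = b y x, forall x, b x x = 0 & forall x, \sum_y b x y = 0].

(** The summand vanishes unless [k] or [l] is [m] or [m']. Each of these four coincidences
    contributes [n * b m m'], since rows and columns sum to zero. The pairs [(m, m')] and [(m', m)]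
    are counted in two of them while the true difference is 0, so [2 * b m m'] is subtracted for
    each. *)
Lemma sum_tperm_diff b (m m' : 'I_n) : centered b -> m != m' ->
  \sum_k \sum_l (b m m' - b (tperm k l m) (tperm k l m')) = 4 * (n%:R - 1) * b m m'.
Proof.
move=> [bC b0 bS] mm'.
have E k l : b m m' - b (tperm k l m) (tperm k l m') =
   (if k == m then b m m' - b l m' else 0) + (if l == m then b m m' - b k m' else 0)
   + ((if k == m' then b m m' - b m l else 0) + (if l == m' then b m m' - b m k else 0))
   - ((if (k == m) then if (l == m') then 2 * b m m' else 0 else 0)
    + (if (k == m') then if (l == m) then 2 * b m m' else 0 else 0)).
    rewrite !permE /= ![m == _]eq_sym ![m' == _]eq_sym.
    case: (k =P m) => ?; case: (l =P m') => ?; case: (l =P m) => ?;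
      case: (k =P m') => ?; subst; rewrite ?b0 ?eqxx // in mm' *; by [ring | rewrite (bC m'); ring].
  under eq_bigr => k _ do under eq_bigr => l _ do rewrite E.
  have sc (i : 'I_n) (F : 'I_n -> R) : \sum_k (if k == i then F k else 0) = F i.
    by rewrite -big_mkcond big_pred1_eq.
  have sz (P : bool) (F : 'I_n -> R) : \sum_k (if P then F k else 0) = if P then \sum_k F k else 0.
    by case: P => //; rewrite big1.
  have bS' y : \sum_x b x y = 0 by under eq_bigr => x _ do rewrite bC; exact: bS.
  have cst : \sum_(k < n) b m m' = n%:R * b m m' by rewrite sumr_const card_ord mulr_natl.
  under eq_bigr => k _ do
    rewrite sumrB !big_split /= !sz !sc sumrB cst bS' sumrB cst bS.
  rewrite sumrB !big_split /= !sc !sumrN cst bS' bS; ring.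
Qed.

(** The statistic of [tau ^ s], reindexed by [s] (see [cost_conj]): [tau] stays fixed and all
    randomness sits in [s]. *)
Definition cost (b : 'I_n -> 'I_n -> R) (tau s : {perm 'I_n}) : R :=
  \sum_m b (s m) (s (tau m)).

Lemma centered_perm b (s : {perm 'I_n}) :
  centered b -> centered (fun x y => b (s x) (s y)).
Proof.
move=> [bC b0 bS]; split=> [x y|x|x]; [exact: bC|exact: b0|].
by have := bS (s x); rewrite (reindex_inj (@perm_inj _ s)).
Qed.

(** This is the linear regression property of the pair [s], [tperm k l * s]. It is [sum_tperm_diff]
    summed over the edges [(m, tau m)], which have distinct ends. *)
Lemma sum_cost_tperm b (tau s : {perm 'I_n}) :
  centered b -> (forall m, tau m != m) ->
  \sum_k \sum_l (cost b tau s - cost b tau (tperm k l * s)%g)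
    = 4 * (n%:R - 1) * cost b tau s.
Proof.
move=> bc tau_fpf.
under eq_bigr => k _ do under eq_bigr => l _ do rewrite /cost -sumrB.
under eq_bigr => k _ do rewrite exchange_big.
rewrite exchange_big mulr_sumr; apply: eq_bigr => m _ /=.
rewrite -(@sum_tperm_diff _ m (tau m) (centered_perm s bc)) 1?eq_sym //.
by apply: eq_bigr => k _; apply: eq_bigr => l _; rewrite !permM.
Qed.

Lemma sum_perm_mull (t : {perm 'I_n}) (F : {perm 'I_n} -> R) :
  \sum_s F (t * s)%g = \sum_s F s.
Proof. by rewrite [RHS](reindex_inj (mulgI t)). Qed.

(** Multiply the regression identity by [2 * g (Y s)] and antisymmetrize: for fixed [k], [l] the
    substitution of [t * s] for [s] swaps the two members of the pair. *)
Lemma stein_exchange b (tau : {perm 'I_n}) (g : R -> R) (Y := cost b tau) :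
  centered b -> (forall m, tau m != m) ->
  8 * (n%:R - 1) * \sum_s Y s * g (Y s) =
  \sum_k \sum_l \sum_s (g (Y s) - g (Y (tperm k l * s)%g)) * (Y s - Y (tperm k l * s)%g).
Proof.
move=> bc tau_fpf.
transitivity (\sum_k \sum_l \sum_s (2 * g (Y s) * (Y s - Y (tperm k l * s)%g))).
  rewrite mulr_sumr; under [RHS]eq_bigr => k _ do rewrite exchange_big.
  rewrite exchange_big /=; apply: eq_bigr => s _.
  under [RHS]eq_bigr => k _ do rewrite -mulr_sumr.
  by rewrite -mulr_sumr sum_cost_tperm // -/(Y s); ring.
apply: eq_bigr => k _; apply: eq_bigr => l _.
set t := tperm k l.
have E : \sum_s g (Y (t * s)%g) * (Y s - Y (t * s)%g) = \sum_s g (Y s) * (Y (t * s)%g - Y s).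
  rewrite -[RHS](sum_perm_mull t); apply: eq_bigr => s _.
  by rewrite mulgA tperm2 mul1g.
under [RHS]eq_bigr => s _ do rewrite mulrBl.
rewrite sumrB E -sumrB; apply: eq_bigr => s _; ring.
Qed.

(* Uniform [s] is sent to the uniform law on the permutations agreeing with [r] on [l], because
   [match_on r l] is equivariant under the permutations fixing [l] pointwise ([match_on_mul]). *)
Definition match_on (r : {perm 'I_n}) (l : seq 'I_n) (s : {perm 'I_n}) : {perm 'I_n} :=
  foldl (fun (u : {perm 'I_n}) q => (tperm q (u^-1 (r q)) * u)%g) s l.

Lemma match_on_fix (r : {perm 'I_n}) l (s : {perm 'I_n}) q :
  s q = r q -> match_on r l s q = r q.
Proof.
elim: l s => //= p l IH s sq; apply: IH; rewrite permM.
case: tpermP => [->|Eq|//]; first by rewrite permKV.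
suff /perm_inj-> : r p = r q by [].
by rewrite -sq Eq permKV.
Qed.

Lemma match_on_in (r : {perm 'I_n}) (l : seq 'I_n) (s : {perm 'I_n}) q :
  q \in l -> match_on r l s q = r q.
Proof.
elim: l s => //= p l IH s; rewrite inE => /orP[/eqP->|]; last exact: IH.
by apply: match_on_fix; rewrite permM tpermL permKV.
Qed.

Lemma match_on_out (r : {perm 'I_n}) (l : seq 'I_n) (s : {perm 'I_n}) q :
  q \notin l -> s q \notin map r l -> match_on r l s q = s q.
Proof.
elim: l s => //= p l IH s; rewrite !inE !negb_or => /andP[qp ql] /andP[sqp sql].
have E : (tperm p (s^-1%g (r p)) * s)%g q = s q.
  rewrite permM tpermD // 1?eq_sym //; apply: contra sqp => /eqP ->.
  by rewrite permKV.
by rewrite IH ?E.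
Qed.

Lemma match_on_mul (r : {perm 'I_n}) (l : seq 'I_n) (h s : {perm 'I_n}) :
  {in l, forall q, h q = q} -> match_on r l (h * s)%g = (h * match_on r l s)%g.
Proof.
elim: l s => //= p l IH s hl; rewrite -IH; last first.
  by move=> q ql; apply: hl; rewrite inE ql orbT.
congr match_on.
have <- : ((tperm p ((h * s)^-1 (r p))) ^ h = tperm p (s^-1 (r p)))%g.
  by rewrite tpermJ hl ?mem_head // invMg permM permKV.
by rewrite [RHS]mulgA -conjgC -mulgA.
Qed.

(** For independent uniform [r] and [s], [match_on r l s] is uniform on the permutations agreeing
    with [r] on [l]. As [g] sees only those values of [r], the pair [r], [match_on r l s] may be
    replaced by [r], [r]. *)
Lemma decouple (g F : {perm 'I_n} -> R) (l : seq 'I_n) :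
  (forall r r' : {perm 'I_n}, {in l, r =1 r'} -> g r = g r') ->
  \sum_r \sum_s g r * F (match_on r l s) = #|{perm 'I_n}|%:R * \sum_r g r * F r.
Proof.
(* [H] is the pointwise stabilizer of [l], so [H * r] is the set of permutations agreeing with [r]
   on [l]. Both sides are averaged over this coset. *)
move=> gl; pose H := [set h : {perm 'I_n} | all (fun q => h q == q) l].
have HP (h : {perm 'I_n}) : reflect {in l, forall q, h q = q} (h \in H).
  by rewrite inE; apply: (iffP allP) => hl q /hl /eqP.
have H0 : #|H|%:R != 0 :> R.
  rewrite pnatr_eq0 -lt0n; apply/card_gt0P; exists 1%g.
  by apply/HP => q _; rewrite perm1.
have HM (h k : {perm 'I_n}) : k \in H -> ((h * k)%g \in H) = (h \in H).
  move=> /HP kH; apply/HP/HP => hH q ql; last by rewrite permM hH ?kH.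
  by apply: (@perm_inj _ k); move: (hH q ql); rewrite permM => ->; rewrite kH.
apply: (mulfI H0).
transitivity (\sum_r \sum_(s : {perm 'I_n}) \sum_(h in H) g r * F (h * r)%g).
  have -> c : #|H|%:R * c = \sum_(h in H) c :> R by rewrite sumr_const mulr_natl.
  transitivity (\sum_(h in H) \sum_r \sum_s g r * F (h * match_on r l s)%g).
    apply: eq_bigr => h /HP hH; apply: eq_bigr => r _.
    rewrite -[LHS](sum_perm_mull h); apply: eq_bigr => s _.
    by rewrite match_on_mul.
  rewrite exchange_big; apply: eq_bigr => r _; rewrite exchange_big; apply: eq_bigr => s _.
  set w := match_on r l s.
  have kH : (w * r^-1)%g \in H.
    by apply/HP => q ql; rewrite permM /w match_on_in ?permK.
  rewrite [RHS](reindex_inj (mulIg (w * r^-1)%g)) /=.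
  apply: eq_big => [h|h _]; first by rewrite (HM _ _ kH).
  by rewrite -!mulgA mulVg mulg1.
under eq_bigr => r _ do rewrite sumr_const.
rewrite sumrMnl mulrCA -[LHS]mulr_natl; congr *%R.
rewrite exchange_big /= mulr_natl -sumr_const; apply: eq_bigr => h /HP hH.
rewrite -[RHS](sum_perm_mull h); apply: eq_bigr => r _.
by rewrite (gl r (h * r)%g) // => q ql; rewrite permM hH.
Qed.

(** A summand [m] can change only if [m] or [tau m] lies in [l] (the set [U]), or if [s] sends [m]
    or [tau m] to one of the values being forced (the set [V], at most two positions per value).
    Each change is at most [2 * beta]. *)
Lemma cost_match_on b beta (tau r s : {perm 'I_n}) l :
  0 <= beta -> (forall x y, `|b x y| <= beta) ->
  `|cost b tau (match_on r l s) - cost b tau s| <=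
  2 * beta * (#|[set m | (m \in l) || (tau m \in l)]| + 2 * size l)%:R.
Proof.
move=> beta0 bb; set U := [set m | _]; pose Q := [set m | s m \in map r l].
pose V := Q :|: tau @^-1: Q.
have cQ : (#|Q| <= size l)%N.
  rewrite -(size_map r) -(card_imset _ (@perm_inj _ s)).
  apply: leq_trans (card_size _); apply: subset_leq_card.
  by apply/subsetP => x /imsetP[y]; rewrite inE => yl ->.
have cV : (#|V| <= 2 * size l)%N.
  apply: leq_trans (leq_card_setU _ _) _.
  by rewrite mul2n -addnn leq_add // card_preimset //; apply: perm_inj.
rewrite /cost -sumrB; apply: le_trans (ler_norm_sum _ _ _) _.
rewrite (bigID (fun m => m \in U :|: V)) /= [X in _ + X]big1 ?addr0; last first.
  move=> m; rewrite !inE !negb_or => /andP[/andP[ml tml] /andP[sm stm]].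
  by rewrite !match_on_out ?subrr ?normr0.
apply: le_trans (_ : \sum_(m in U :|: V) 2 * beta <= _).
  apply: ler_sum => m _; apply: le_trans (ler_normB _ _) _.
  by rewrite mulrDl mul1r lerD.
rewrite sumr_const -[leLHS]mulr_natr ler_wpM2l ?mulr_ge0 ?ler0n // ler_nat.
by apply: leq_trans (leq_card_setU _ _) _; rewrite leq_add2l.
Qed.

(** * The points that determine the effect of a transposition *)

Definition nbhd (tau : {perm 'I_n}) (k l : 'I_n) : seq 'I_n :=
  undup [:: k; tau k; (tau^-1 k)%g; l; tau l; (tau^-1 l)%g].

Lemma cost_tperm_local b (tau r s : {perm 'I_n}) k l (Y := cost b tau) :
  {in nbhd tau k l, r =1 s} ->
  Y r - Y (tperm k l * r)%g = Y s - Y (tperm k l * s)%g.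
Proof.
move=> rs; pose P := [:: k; tau k; (tau^-1 k)%g; l; tau l; (tau^-1 l)%g].
have {}rs q : q \in P -> r q = s q.
  by move=> qP; apply: rs; rewrite mem_undup.
rewrite /Y /cost -!sumrB; apply: eq_bigr => m _; rewrite !permM.
case: (boolP ((m \in [:: k; l]) || (tau m \in [:: k; l]))) => mkl.
  have mP : m \in P.
    by case/orP: mkl; rewrite !inE => /orP[] /eqP <-; rewrite ?permK ?eqxx ?orbT.
  have tmP : tau m \in P.
    by case/orP: mkl; rewrite !inE => /orP[] /eqP ->; rewrite ?eqxx ?orbT.
  have tP q : q \in P -> tperm k l q \in P.
    by case: tpermP; rewrite ?inE ?eqxx ?orbT.
  by rewrite !rs ?tP.
move: mkl; rewrite !inE !negb_or => /andP[/andP[mk ml] /andP[tk tl]].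
by rewrite !tpermD 1?eq_sym // !subrr.
Qed.

Lemma size_nbhd tau k l : (size (nbhd tau k l) <= 6)%N.
Proof. exact: size_undup. Qed.

(** Taking preimages under [tau] adds only the second predecessors of [k] and [l] to the six
    points. *)
Lemma card_nbhd (tau : {perm 'I_n}) k l (P := nbhd tau k l) :
  (#|[set m | (m \in P) || (tau m \in P)]| <= 8)%N.
Proof.
pose t' := (tau^-1)%g.
apply: leq_trans (card_size [:: k; tau k; t' k; t' (t' k); l; tau l; t' l; t' (t' l)]).
apply: subset_leq_card; apply/subsetP => m.
rewrite inE !mem_undup => /orP[].
  by rewrite !inE => /or4P[|||/or3P[]] /eqP->; rewrite ?eqxx ?orbT.
rewrite !inE -(inj_eq (@perm_inj _ t')) permK.
rewrite -![tau m == _](inj_eq (@perm_inj _ t')) !permK.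
by move=> /or4P[|||/or3P[]] /eqP->; rewrite ?eqxx ?orbT.
Qed.

(** Here [tau^-1 = tau], so successors and predecessors coincide; [nbhd] removes duplicates to make
    this count visible. *)
Lemma size_nbhd_involution (tau : {perm 'I_n}) k l :
  (forall m, tau (tau m) = m) -> (size (nbhd tau k l) <= 4)%N.
Proof.
move=> tau2; rewrite -(card_uniqP (undup_uniq _)).
apply: leq_trans (card_size [:: k; tau k; l; tau l]).
apply: subset_leq_card; apply/subsetP => m; rewrite mem_undup.
have tV x : (tau^-1 x)%g = tau x by rewrite -{1}(tau2 x) permK.
by rewrite !tV !inE => /or4P[|||/or3P[]] ->; rewrite ?orbT.
Qed.

Lemma card_nbhd_involution (tau : {perm 'I_n}) k l (P := nbhd tau k l) :
  (forall m, tau (tau m) = m) ->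
  (#|[set m | (m \in P) || (tau m \in P)]| <= 4)%N.
Proof.
move=> tau2.
apply: leq_trans (card_size [:: k; tau k; l; tau l]).
apply: subset_leq_card; apply/subsetP => m; rewrite inE !mem_undup.
have tV x : (tau^-1 x)%g = tau x by rewrite -{1}(tau2 x) permK.
have tE x : (tau m == x) = (m == tau x) by rewrite -{1}(tau2 x) (inj_eq perm_inj).
rewrite !tV => /orP[].
  by rewrite !inE => /or4P[|||/or3P[]] ->; rewrite ?orbT.
by rewrite !inE !tE !tau2 => /or4P[|||/or3P[]] ->; rewrite ?orbT.
Qed.

(** [stein_exchange] is used twice: with [id] it turns the second moment into the sum of the
    [D k l s ^+ 2], and with [f] it bounds the left side, via [fconv], by the sum of
    [D k l s ^+ 2 * f (Y s)]. [decouple] separates these two factors, [fC] paying the price [C]. *)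
Lemma zero_bias_ineq b beta (tau : {perm 'I_n}) (N : nat) (f : R -> R) (theta C : R)
    (Y := cost b tau) :
  (1 < n)%N -> centered b -> 0 <= beta -> (forall x y, `|b x y| <= beta) ->
  (forall m, tau m != m) ->
  (forall k l (P := nbhd tau k l),
     #|[set m | (m \in P) || (tau m \in P)]| + 2 * size P <= N)%N ->
  0 <= theta ->
  (forall x y, (f x - f y) * (x - y) <= theta * ((x - y) ^+ 2 * ((f x + f y) / 2))) ->
  (forall x y, `|x - y| <= 2 * beta * N%:R -> f x <= C * f y) ->
  #|{perm 'I_n}|%:R * \sum_s Y s * f (Y s)
    <= theta * C * (\sum_s Y s ^+ 2) * \sum_s f (Y s).
Proof.
move=> n1 bc beta0 bb tau_fpf PN theta0 fconv fC.
pose D k l s := Y s - Y (tperm k l * s)%g.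
have DN k l s : D k l (tperm k l * s)%g = - D k l s.
  by rewrite /D mulgA tperm2 mul1g opprB.
have c0 : 0 < 8 * (n%:R - 1) :> R by rewrite mulr_gt0 // subr_gt0 ltr1n.
have EY : 8 * (n%:R - 1) * \sum_s Y s ^+ 2 = \sum_k \sum_l \sum_s D k l s ^+ 2.
  have -> : \sum_s Y s ^+ 2 = \sum_s Y s * Y s by apply: eq_bigr => s _; rewrite expr2.
  by rewrite (stein_exchange id bc tau_fpf).
have Ef : 8 * (n%:R - 1) * \sum_s Y s * f (Y s)
    <= theta * \sum_k \sum_l \sum_s D k l s ^+ 2 * f (Y s).
  rewrite (stein_exchange f bc tau_fpf) mulr_sumr; apply: ler_sum => k _.
  rewrite mulr_sumr; apply: ler_sum => l _.
  apply: (@le_trans _ _ (theta * \sum_s D k l s ^+ 2 * ((f (Y s) + f (Y (tperm k l * s)%g)) / 2))).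
    by rewrite mulr_sumr; apply: ler_sum => s _; apply: fconv.
  rewrite ler_wpM2l //.
  have -> : \sum_s D k l s ^+ 2 * ((f (Y s) + f (Y (tperm k l * s)%g)) / 2) =
    (\sum_s D k l s ^+ 2 * f (Y s) + \sum_s D k l s ^+ 2 * f (Y (tperm k l * s)%g)) / 2.
    by rewrite -big_split mulr_suml; apply: eq_bigr => s _ /=; field.
  (* The square of [D] is invariant under swapping the pair, so both halves of the average have the
     same sum. *)
  have -> : \sum_s D k l s ^+ 2 * f (Y (tperm k l * s)%g) = \sum_s D k l s ^+ 2 * f (Y s).
    rewrite -[RHS](sum_perm_mull (tperm k l)).
    by apply: eq_bigr => s _; rewrite DN sqrrN.
  by move: (\sum_s _) => A; lra.
have dec k l : #|{perm 'I_n}|%:R * \sum_s D k l s ^+ 2 * f (Y s)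
    <= C * (\sum_s D k l s ^+ 2) * \sum_s f (Y s).
  rewrite -(@decouple (fun s => D k l s ^+ 2) (fun s => f (Y s)) (nbhd tau k l)); last first.
    by move=> r r' rr'; congr (_ ^+ 2); apply: cost_tperm_local.
  rewrite -mulrA mulr_suml mulr_sumr; apply: ler_sum => r _.
  rewrite !mulr_sumr; apply: ler_sum => s _.
  rewrite mulrCA ler_wpM2l ?sqr_ge0 //; apply: fC.
  apply: le_trans (cost_match_on _ _ _ _ beta0 bb) _.
  by rewrite ler_wpM2l ?mulr_ge0 // ler_nat.
rewrite -(ler_pM2l c0) mulrCA.
apply: le_trans (ler_wpM2l (ler0n _ _) Ef) _.
rewrite mulrCA.
have -> : 8 * (n%:R - 1) * (theta * C * (\sum_s Y s ^+ 2) * \sum_s f (Y s)) =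
  theta * (C * (8 * (n%:R - 1) * \sum_s Y s ^+ 2) * \sum_s f (Y s)) by ring.
rewrite EY ler_wpM2l //; move: (\sum_s f (Y s)) dec => F dec.
rewrite !mulr_sumr mulr_suml; apply: ler_sum => k _.
rewrite !mulr_sumr mulr_suml; apply: ler_sum => l _.
exact: dec.
Qed.

(** * Second moment of the cost *)

Lemma sum_mul_centered b (psi : {perm 'I_n} -> R) (Q : {set 'I_n}) k m :
  centered b -> k \in Q -> m \notin Q ->
  (forall z s, z \notin Q -> psi (tperm m z * s)%g = psi s) ->
  (n%:R - #|Q|%:R) * \sum_s psi s * b (s k) (s m)
    = - \sum_(z in Q) \sum_s psi s * b (s k) (s z).
Proof.
move=> bc kQ mQ psiQ.
(* Swapping [m] and [z] preserves [psi] and [s k], so all points outside [Q] contribute equally; the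
   row of [s k] sums to zero, which moves their total to the points of [Q]. *)
have E z : z \in ~: Q -> \sum_s psi s * b (s k) (s z) = \sum_s psi s * b (s k) (s m).
  rewrite inE => zQ; rewrite -[RHS](sum_perm_mull (tperm m z)); apply: eq_bigr => s _.
  rewrite psiQ // !permM tpermL tpermD //; first by apply: contraNneq mQ => ->.
  by apply: contraNneq zQ => ->.
have -> : n%:R - #|Q|%:R = #|~: Q|%:R :> R.
  by have := cardsC Q; rewrite card_ord => /(congr1 (fun i => i%:R : R)); rewrite natrD; lra.
rewrite mulr_natl -sumr_const -(eq_bigr _ E); apply/eqP.
rewrite -addr_eq0 addrC; apply/eqP.
rewrite (_ : _ + _ = \sum_z \sum_s psi s * b (s k) (s z)); last first.
  rewrite [RHS](bigID (mem Q)) /=; congr +%R.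
  by apply: eq_bigl => z; rewrite inE.
rewrite exchange_big big1 // => s _; rewrite -mulr_sumr.
by have [_ _ ->] := centered_perm s bc; rewrite mulr0.
Qed.

Lemma sum_path b (k k' m : 'I_n) : centered b -> k' != k -> m != k -> m != k' ->
  (n%:R - 2) * \sum_(s : {perm 'I_n}) b (s k) (s k') * b (s k') (s m)
    = - \sum_(s : {perm 'I_n}) b (s k) (s k') ^+ 2.
Proof.
move=> bc kk' mk mk'; have [bC b0 _] := bc.
have := @sum_mul_centered b (fun s => b (s k) (s k')) [set k; k'] k' m bc.
rewrite !inE eqxx orbT (negbTE mk) (negbTE mk') => /(_ isT isT).
rewrite cards2 eq_sym kk' => ->.
  rewrite big_setU1 ?inE 1?eq_sym // big_set1 /=.
  rewrite [X in _ + X]big1 ?addr0 => [|s _]; last by rewrite b0 mulr0.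
  by congr -%R; apply: eq_bigr => s _; rewrite expr2 (bC (s k')).
move=> z s; rewrite !inE negb_or => /andP[zk zk'].
by rewrite !permM !tpermD.
Qed.

(** Averaging out [m'] with [Q] consisting of [k], [k'] and [m] leaves two paths, through [k] and
    through [k'], each evaluated by [sum_path]. *)
Lemma sum_disjoint b (k k' m m' : 'I_n) : centered b -> uniq [:: k; k'; m; m'] ->
  (n%:R - 3) * (n%:R - 2) * \sum_(s : {perm 'I_n}) b (s k) (s k') * b (s m) (s m')
    = 2 * \sum_(s : {perm 'I_n}) b (s k) (s k') ^+ 2.
Proof.
move=> bc; rewrite /= !inE !negb_or -!andbA => /and4P[kk' km km' /and4P[k'm k'm' mm' _]].
have [bC b0 _] := bc.
have := @sum_mul_centered b (fun s => b (s k) (s k')) (m |: [set k; k']) m m' bc.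
rewrite !inE eqxx !(eq_sym m') (negbTE km') (negbTE k'm') (negbTE mm') => /(_ isT isT).
rewrite cardsU1 cards2 !inE kk' !(eq_sym m) (negbTE km) (negbTE k'm) /=.
have -> : (1 + 2)%N = 3 by [].
rewrite mulrAC => ->; last first.
  move=> z s; rewrite !inE !negb_or => /and3P[zm zk zk'].
  by rewrite !permM !tpermD // eq_sym.
rewrite big_setU1 ?inE ?negb_or ?[m == _]eq_sym ?km ?k'm //.
rewrite big_setU1 ?inE // big_set1 /=.
rewrite big1 ?add0r => [|s _]; last by rewrite b0 mulr0.
have E1 := @sum_path b k k' m bc; rewrite eq_sym kk' !(eq_sym m) km k'm in E1.
have E2 := @sum_path b k' k m bc; rewrite kk' !(eq_sym m) km k'm in E2.
rewrite mulNr mulrDl mulrC; under eq_bigr => s _ do rewrite bC (bC (s m)).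
rewrite E2 // mulrC; under [X in _ * X]eq_bigr => s _ do rewrite (bC (s m)).
rewrite E1 //; under eq_bigr => s _ do rewrite bC.
ring.
Qed.

(** For uniform [s] and [z != k] the pair [(s k, s z)] has a law independent of [z], so [tau k]
    stands for any of the [n - 1] choices. *)
Lemma sum_edge_sq b (tau : {perm 'I_n}) : centered b -> (forall m, tau m != m) ->
  (n%:R - 1) * \sum_k \sum_(s : {perm 'I_n}) b (s k) (s (tau k)) ^+ 2
    = #|{perm 'I_n}|%:R * \sum_x \sum_y b x y ^+ 2.
Proof.
move=> [bC b0 bS] tau_fpf.
have -> : #|{perm 'I_n}|%:R * \sum_x \sum_y b x y ^+ 2
    = \sum_(s : {perm 'I_n}) \sum_k \sum_z b (s k) (s z) ^+ 2.
  rewrite mulr_natl -sumr_const; apply: eq_bigr => s _.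
  rewrite [LHS](reindex_inj (@perm_inj _ s)); apply: eq_bigr => k _.
  by rewrite [LHS](reindex_inj (@perm_inj _ s)).
rewrite mulr_sumr [RHS]exchange_big; apply: eq_bigr => k _ /=.
rewrite [RHS]exchange_big (bigD1 k) //= [X in _ = X + _]big1 ?add0r; last first.
  by move=> s _; rewrite b0 expr0n.
have E z : z != k ->
    \sum_(s : {perm 'I_n}) b (s k) (s z) ^+ 2
    = \sum_(s : {perm 'I_n}) b (s k) (s (tau k)) ^+ 2.
  move=> zk; rewrite -[RHS](sum_perm_mull (tperm (tau k) z)).
  by apply: eq_bigr => s _; rewrite !permM tpermL tpermD.
rewrite (eq_bigr _ E) sumr_const -[RHS]mulr_natl; congr (_ * _).
have := cardC1 k; rewrite card_ord => ->.
by rewrite -subn1 natrB // (leq_ltn_trans _ (ltn_ord k)).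
Qed.

Lemma sum_cost_sq b (tau : {perm 'I_n}) :
  \sum_s cost b tau s ^+ 2 =
  \sum_k \sum_m \sum_(s : {perm 'I_n}) b (s k) (s (tau k)) * b (s m) (s (tau m)).
Proof.
under [RHS]eq_bigr => k _ do rewrite exchange_big.
rewrite [RHS]exchange_big; apply: eq_bigr => s _.
by rewrite expr2 /cost mulr_suml; apply: eq_bigr => k _; rewrite mulr_sumr.
Qed.

Lemma sum_if_eq (i : 'I_n) (c : R) : \sum_k (if k == i then c else 0) = c.
Proof. by rewrite -big_mkcond big_pred1_eq. Qed.

(** Fix [k]. The edge of [k] itself gives [E], its two neighbouring edges give [- E / (n - 2)] each,
    and the [n - 3] disjoint edges give [q] each. Since [(n - 3) * q = 2 * E / (n - 2)], only [E]
    survives. *)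
Lemma sum_cost_sq_no2 b (tau : {perm 'I_n}) : (4 <= n)%N -> centered b ->
  (forall m, tau m != m) -> (forall m, tau (tau m) != m) ->
  \sum_s cost b tau s ^+ 2
    = #|{perm 'I_n}|%:R * ((n%:R - 1)^-1 * \sum_x \sum_y b x y ^+ 2).
Proof.
move=> n4 bc fpf no2; rewrite sum_cost_sq.
have n4R : 4 <= n%:R :> R by rewrite ler_nat.
rewrite mulrCA -(sum_edge_sq bc fpf) mulKf; last lra.
apply: eq_bigr => k _; have [bC _ _] := bc.
set E := \sum_s _ ^+ 2; pose t' := (tau^-1)%g.
have tk : tau (t' k) = k by rewrite permKV.
have t'k : t' k != k by rewrite -{2}tk eq_sym fpf.
have tkt' : tau k != t' k by rewrite -{1}tk; apply: no2.
pose q := 2 * E / ((n%:R - 3) * (n%:R - 2)).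
have X m : \sum_(s : {perm 'I_n}) b (s k) (s (tau k)) * b (s m) (s (tau m)) =
    q + (if m == k then E - q else 0) + (if m == tau k then - E / (n%:R - 2) - q else 0)
      + (if m == t' k then - E / (n%:R - 2) - q else 0).
  case: (eqVneq m k) => [->|mk].
    rewrite ![k == _]eq_sym (negbTE (fpf k)) (negbTE t'k) !addr0 addrC subrK.
    by apply: eq_bigr => s _; rewrite expr2.
  case: (eqVneq m (tau k)) => [->|mtk].
    rewrite (negbTE tkt') !addr0 addrC subrK.
    have := sum_path bc (fpf k) (no2 k) (fpf _).
    by rewrite -/E => <-; field; lra.
  case: (eqVneq m (t' k)) => [->|mt'k].
    rewrite !addr0 addrC subrK tk.
    have := @sum_path b (tau k) k (t' k) bc; rewrite eq_sym fpf [t' k == _]eq_sym tkt' t'k.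
    under [in RHS]eq_bigr => s _ do rewrite bC.
    move=> /(_ isT isT isT) <-; rewrite mulrAC divff ?mul1r; last by lra.
    by apply: eq_bigr => s _; rewrite bC (bC (s k)).
  rewrite !addr0 /q -(@sum_disjoint _ k (tau k) m (tau m) bc).
    by field; apply/andP; split; lra.
  have ktm : k != tau m by apply: contraNneq mt'k => ->; rewrite /t' permK.
  have kt : k != tau k by rewrite eq_sym.
  have mt : m != tau m by rewrite eq_sym.
  have tktm : tau k != tau m by rewrite (inj_eq perm_inj) eq_sym.
  rewrite eq_sym in mk; rewrite eq_sym in mtk.
  by rewrite /= !inE !negb_or kt mk ktm mtk tktm mt.
under eq_bigr => m _ do rewrite X.
rewrite !big_split /= !sum_if_eq sumr_const card_ord -mulr_natl /q.
by field; apply/andP; split; lra.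
Qed.

(** Each edge occurs twice, from [k] and from [tau k], giving [2 * E]; the other [n - 2] positions
    give [q] each, for a total of [2 * E * (n - 2) / (n - 3)]. *)
Lemma sum_cost_sq_involution b (tau : {perm 'I_n}) : (4 <= n)%N -> centered b ->
  (forall m, tau m != m) -> (forall m, tau (tau m) = m) ->
  \sum_s cost b tau s ^+ 2
    = #|{perm 'I_n}|%:R * (2 * (n%:R - 2) / ((n%:R - 1) * (n%:R - 3))
      * \sum_x \sum_y b x y ^+ 2).
Proof.
move=> n4 bc fpf inv; rewrite sum_cost_sq.
have n4R : 4 <= n%:R :> R by rewrite ler_nat.
rewrite mulrCA -(sum_edge_sq bc fpf) mulr_sumr mulr_sumr.
apply: eq_bigr => k _; have [bC _ _] := bc.
set E := \sum_s _ ^+ 2.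
pose q := 2 * E / ((n%:R - 3) * (n%:R - 2)).
have X m : \sum_(s : {perm 'I_n}) b (s k) (s (tau k)) * b (s m) (s (tau m)) =
    q + (if m == k then E - q else 0) + (if m == tau k then E - q else 0).
  case: (eqVneq m k) => [->|mk].
    rewrite ![k == _]eq_sym (negbTE (fpf k)) !addr0 addrC subrK.
    by apply: eq_bigr => s _; rewrite expr2.
  case: (eqVneq m (tau k)) => [->|mtk].
    rewrite !addr0 addrC subrK inv.
    by apply: eq_bigr => s _; rewrite expr2 (bC (s (tau k))).
  rewrite !addr0 /q -(@sum_disjoint _ k (tau k) m (tau m) bc).
    by field; apply/andP; split; lra.
  have ktm : k != tau m by apply: contraNneq mtk => ->; rewrite inv.
  have kt : k != tau k by rewrite eq_sym.
  have mt : m != tau m by rewrite eq_sym.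
  have tktm : tau k != tau m by rewrite (inj_eq perm_inj) eq_sym.
  rewrite eq_sym in mk; rewrite eq_sym in mtk.
  by rewrite /= !inE !negb_or kt mk ktm mtk tktm mt.
under eq_bigr => m _ do rewrite X.
rewrite !big_split /= !sum_if_eq sumr_const card_ord -[q *+ n]mulr_natl /q.
by field; repeat (apply/andP; split); lra.
Qed.

(** * Laws invariant under conjugation *)

Lemma sum_perm_conj (p F : {perm 'I_n} -> R) :
  (forall tau s : {perm 'I_n}, p (tau ^ s)%g = p tau) ->
  #|{perm 'I_n}|%:R * \sum_tau p tau * F tau
    = \sum_tau p tau * \sum_s F (tau ^ s)%g.
Proof.
move=> pJ; rewrite mulr_natl -sumr_const.
under [RHS]eq_bigr => tau _ do rewrite mulr_sumr.
rewrite [RHS]exchange_big; apply: eq_bigr => s _ /=.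
rewrite (reindex_inj (@conjg_inj _ s)); apply: eq_bigr => tau _.
by rewrite pJ.
Qed.

Lemma cost_conj b (tau s : {perm 'I_n}) :
  \sum_i b i ((tau ^ s)%g i) = cost b tau s.
Proof.
rewrite (reindex_inj (@perm_inj _ s)).
by apply: eq_bigr => m _; rewrite permJ.
Qed.

Lemma card_perm_gt0 : 0 < #|{perm 'I_n}|%:R :> R.
Proof. by rewrite ltr0n; apply/card_gt0P; exists 1%g. Qed.

(** For a constant function the right side of [stein_exchange] vanishes, so the cost averages to
    zero over [s] for each [tau] in the support. *)
Lemma sum_perm_cost_eq0 b (p : {perm 'I_n} -> R) : (1 < n)%N -> centered b ->
  (forall tau s : {perm 'I_n}, p (tau ^ s)%g = p tau) ->
  (forall tau, p tau != 0 -> forall m, tau m != m) ->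
  \sum_tau p tau * \sum_i b i (tau i) = 0.
Proof.
move=> n1 bc pJ fpf; have S0 := card_perm_gt0.
apply: (mulfI (lt0r_neq0 S0)).
rewrite mulr0 sum_perm_conj //; apply: big1 => tau _.
have [->|/fpf tau_fpf] := eqVneq (p tau) 0; first by rewrite mul0r.
under eq_bigr => s _ do rewrite cost_conj.
have /= := stein_exchange (fun _ => 1) bc tau_fpf.
under eq_bigr => s _ do rewrite mulr1.
have c0 : 8 * (n%:R - 1) != 0 :> R.
  by apply: lt0r_neq0; rewrite mulr_gt0 // subr_gt0 ltr1n.
rewrite [RHS]big1 => [/eqP|k _]; last first.
  by rewrite big1 // => l _; rewrite big1 // => s _; rewrite subrr mul0r.
by rewrite mulf_eq0 (negbTE c0) => /eqP ->; rewrite mulr0.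
Qed.

(** The law is a mixture over [tau] of the laws of [tau ^ s]. Once the second moment is replaced by
    the common bound [sigma2], the inequality is linear in the mixing weights and can be
    averaged. *)
Lemma zero_bias_ineq_mixture b beta sigma2 (p : {perm 'I_n} -> R) (N : nat)
    (f : R -> R) (theta C : R) (Z := fun tau : {perm 'I_n} => \sum_i b i (tau i)) :
  (1 < n)%N -> centered b -> 0 <= beta -> (forall x y, `|b x y| <= beta) ->
  (forall tau, 0 <= p tau) ->
  (forall tau s : {perm 'I_n}, p (tau ^ s)%g = p tau) ->
  (forall tau, p tau != 0 ->
    [/\ forall m, tau m != m,
      forall k l (P := nbhd tau k l),
        (#|[set m | (m \in P) || (tau m \in P)]| + 2 * size P <= N)%N
      & \sum_s cost b tau s ^+ 2 <= #|{perm 'I_n}|%:R * sigma2]) ->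
  0 <= theta -> 0 <= C -> (forall x, 0 <= f x) ->
  (forall x y, (f x - f y) * (x - y) <= theta * ((x - y) ^+ 2 * ((f x + f y) / 2))) ->
  (forall x y, `|x - y| <= 2 * beta * N%:R -> f x <= C * f y) ->
  \sum_tau p tau * (Z tau * f (Z tau)) <= sigma2 * theta * C * \sum_tau p tau * f (Z tau).
Proof.
move=> n1 bc beta0 bb p0 pJ ptau theta0 C0 f0 fconv fC.
have S0 := card_perm_gt0.
rewrite -(ler_pM2l S0) mulrCA !sum_perm_conj // mulr_sumr.
apply: ler_sum => tau _; rewrite mulrCA.
have [->|/ptau[fpf PN V]] := eqVneq (p tau) 0; first by rewrite !mul0r.
rewrite ler_wpM2l //.
under eq_bigr => s _ do rewrite /Z cost_conj.
under [in leRHS]eq_bigr => s _ do rewrite /Z cost_conj.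
rewrite -(ler_pM2l S0).
apply: le_trans (zero_bias_ineq n1 bc beta0 bb fpf PN theta0 fconv fC) _.
have -> : #|{perm 'I_n}|%:R * (sigma2 * theta * C * \sum_s f (cost b tau s))
  = theta * C * (#|{perm 'I_n}|%:R * sigma2) * \sum_s f (cost b tau s) by ring.
by rewrite ler_wpM2r ?sumr_ge0 // ler_wpM2l // mulr_ge0.
Qed.

(** * Centering the array *)

Section Centering.
Variables (a : 'I_n -> 'I_n -> R) (ai : 'I_n -> R) (a0 : R).
Hypothesis n4 : (4 <= n)%N.
Hypothesis aC : forall i j, a i j = a j i.
Hypothesis aiE : forall i, (n%:R - 2) * ai i = \sum_(j | j != i) a i j.
Hypothesis a0E : (n%:R - 1) * a0 = \sum_i ai i.

Let d i j := a i j - 2 * ai i + a0.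

Definition recenter (i j : 'I_n) : R :=
  if i == j then 0 else a i j - ai i - ai j + a0.

Lemma recenterE i j : i != j -> recenter i j = (d i j + d j i) / 2.
Proof. by move=> ij; rewrite /recenter (negbTE ij) /d (aC j); field. Qed.

(** The normalizations by [n - 2] and [n - 1] are made for this: row [i] sums to [(n - 2) * ai i -
    (n - 1) * ai i - ((n - 1) * a0 - ai i) + (n - 1) * a0 = 0]. *)
Lemma centered_recenter : centered recenter.
Proof.
split=> [i j|i|i]; rewrite /recenter.
- by rewrite eq_sym; case: eqP => // _; rewrite aC; ring.
- by rewrite eqxx.
rewrite (bigD1 i) //= eqxx add0r.
rewrite (eq_bigr (fun j => a i j - ai i - ai j + a0)) => [|j ji]; last first.
  by rewrite eq_sym (negbTE ji).
rewrite !big_split /= !sumrN -aiE.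
have := a0E; rewrite (bigD1 i) //= => E.
have c : #|[pred j | j != i]|%:R = n%:R - 1 :> R.
  have := cardC1 i; rewrite card_ord => ->.
  by rewrite -subn1 natrB // (leq_trans _ n4).
rewrite !sumr_const -[ai i *+ _]mulr_natl -[a0 *+ _]mulr_natl c.
lra.
Qed.

Lemma norm_recenter_le beta i j : 0 <= beta ->
  (forall i j, i != j -> `|d i j| <= beta) -> `|recenter i j| <= beta.
Proof.
move=> beta0 db; have [->|ij] := eqVneq i j; first by rewrite /recenter eqxx normr0.
have ji : j != i by rewrite eq_sym.
rewrite recenterE // ler_norml; have := db _ _ ij; have := db _ _ ji.
by rewrite !ler_norml => /andP[? ?] /andP[? ?]; apply/andP; split; lra.
Qed.

(** Off the diagonal [recenter i j] averages [d i j] and [d j i]; convexity of the square and the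
    symmetry of the index set give the bound. *)
Lemma sum_recenter_sq_le :
  \sum_i \sum_j recenter i j ^+ 2 <= \sum_i \sum_(j | i != j) d i j ^+ 2.
Proof.
have E : \sum_i \sum_j recenter i j ^+ 2 = \sum_i \sum_(j | i != j) recenter i j ^+ 2.
  apply: eq_bigr => i _; rewrite [RHS]big_mkcond; apply: eq_bigr => j _.
  by case: eqVneq => // ->; rewrite /recenter eqxx expr0n.
have sym : \sum_i \sum_(j | i != j) d j i ^+ 2 = \sum_i \sum_(j | i != j) d i j ^+ 2.
  under eq_bigr => i _ do rewrite big_mkcond.
  rewrite exchange_big; apply: eq_bigr => j _ /=; rewrite [RHS]big_mkcond.
  by apply: eq_bigr => i _; rewrite eq_sym.
rewrite E; set D := leRHS.
have -> : D = \sum_i \sum_(j | i != j) (d i j ^+ 2 + d j i ^+ 2) / 2.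
  under [RHS]eq_bigr => i _ do rewrite -mulr_suml big_split.
  by rewrite -mulr_suml big_split /= sym -/D; field.
apply: ler_sum => i _; apply: ler_sum => j ij; rewrite recenterE //.
have := sqr_ge0 (d i j - d j i); lra.
Qed.

Lemma sum_recenter (tau : {perm 'I_n}) : (forall m, tau m != m) ->
  \sum_i recenter i (tau i) = \sum_i a i (tau i) - (n%:R - 2) * a0.
Proof.
move=> fpf.
rewrite (eq_bigr (fun i => a i (tau i) - ai i - ai (tau i) + a0)) => [|i _]; last first.
  by rewrite /recenter eq_sym (negbTE (fpf i)).
have E : \sum_i ai (tau i) = \sum_i ai i.
  by rewrite [RHS](reindex_inj (@perm_inj _ tau)).
rewrite !big_split /= !sumrN E -a0E.
by rewrite sumr_const card_ord -[a0 *+ _]mulr_natl; ring.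
Qed.

End Centering.

(** Lets the lower tail be treated as the upper tail of the negated array. *)
Lemma centeredN b : centered b -> centered (fun x y => - b x y).
Proof.
move=> [bC b0 bS]; split=> [x y|x|x].
- by rewrite (bC x y).
- by rewrite (b0 x) oppr0.
- by rewrite sumrN (bS x) oppr0.
Qed.

End Core.

(** * Conjugation and cycles *)

Lemma porbit_conj (T : finType) (t s : {perm T}) x :
  porbit (t ^ s)%g (s x) = s @: porbit t x.
Proof.
apply/setP => y; apply/porbitP/imsetP => [[i ->]|[z /porbitP[i ->] ->]].
  by exists ((t ^+ i)%g x); rewrite ?mem_porbit // -conjXg permJ.
by exists i; rewrite -conjXg permJ.
Qed.

Lemma porbits_conj (T : finType) (t s : {perm T}) :
  porbits (t ^ s)%g = (fun C : {set T} => s @: C) @: porbits t.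
Proof.
apply/setP => C; apply/imsetP/imsetP => [[x _ ->]|[_ /imsetP[x _ ->] ->]].
  exists (porbit t (s^-1%g x)); first exact: imset_f.
  by rewrite -porbit_conj permKV.
by exists (s x); rewrite // porbit_conj.
Qed.

(** * From permutation statistics to tail bounds *)

Section Bridge.

Lemma RsumE (T : finType) (f : T -> R) : Rsum f = \sum_x f x.
Proof.
rewrite /Rsum -big_enum /=; elim: (enum T) => [|x s IH] /=; first by rewrite big_nil.
by rewrite big_cons IH.
Qed.

Lemma RsumE_cond (T : finType) (P : pred T) (f : T -> R) :
  Rsum (fun x => if P x then f x else 0%R) = \sum_(x | P x) f x.
Proof. by rewrite RsumE [RHS]big_mkcond. Qed.

Variables (n : nat) (a : 'I_n -> 'I_n -> R).
Hypothesis n5 : (5 <= n)%N.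
Hypothesis aC : forall i j, a i j = a j i.

Let n5R : 5 <= n%:R :> R. Proof. by rewrite ler_nat. Qed.
Let n2_neq0 : n%:R - 2 != 0 :> R. Proof. by move: n5R => ?; lra. Qed.
Let n1_neq0 : n%:R - 1 != 0 :> R. Proof. by move: n5R => ?; lra. Qed.

Lemma a_ioE i : (n%:R - 2) * a_io a i = \sum_(j | j != i) a i j.
Proof.
rewrite /a_io RsumE_cond INRE RmultE RminusE RinvE -[IZR 2]/(2%:R : R).
by rewrite mulrA (divff n2_neq0) mul1r.
Qed.

Lemma a_ooE : (n%:R - 1) * a_oo a = \sum_i a_io a i.
Proof.
have -> : \sum_i a_io a i = (n%:R - 2)^-1 * \sum_i \sum_(j | j != i) a i j.
  by rewrite mulr_sumr; apply: eq_bigr => i _; rewrite -a_ioE (mulKf n2_neq0).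
rewrite /a_oo RsumE; under eq_bigr => i _ do rewrite RsumE_cond.
under [in RHS]eq_bigr => i _ do under eq_bigl => j do rewrite eq_sym.
rewrite INRE !RmultE !RminusE RinvE -[IZR 2]/(2%:R : R) -[IZR 1]/(1 : R).
by rewrite invfM -mulrA (mulVKf n1_neq0).
Qed.

Lemma a_centE i j : a_cent a i j = a i j - 2 * a_io a i + a_oo a.
Proof. by []. Qed.

Lemma S_sumE : S_sum a = \sum_i \sum_(j | i != j) (a i j - 2 * a_io a i + a_oo a) ^+ 2.
Proof.
rewrite /S_sum RsumE; apply: eq_bigr => i _; rewrite RsumE_cond.
by apply: eq_bigr => j _; rewrite RpowE.
Qed.

Lemma muE : mu a = (n%:R - 2) * a_oo a.
Proof. by rewrite /mu INRE. Qed.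

Lemma a_o_ge0 : 0 <= a_o a.
Proof.
rewrite /a_o; elim: [seq _ | _ <- _] => [|x s IH] /=; first exact: lexx.
by rewrite RmaxE le_max IH orbT.
Qed.

Lemma a_cent_le i j : i != j -> `|a_cent a i j| <= a_o a.
Proof.
move=> ij; rewrite /a_o.
have : Rabs (a_cent a i j) \in
    [seq Rabs (a_cent a p.1 p.2) | p <- enum [pred p : 'I_n * 'I_n | p.1 != p.2]].
  by apply/mapP; exists (i, j); rewrite ?mem_enum.
rewrite -RabsE; elim: [seq _ | _ <- _] => //= x s IH; rewrite inE RmaxE le_max.
by case/orP => [/eqP->|/IH ->]; rewrite ?lexx ?orbT.
Qed.

(** Guarantees [c > 0], by which the exponents divide: if the maximum were 0, every term of
    [S_sum a] would vanish. *)
Lemma a_o_gt0 : 0 < S_sum a -> 0 < a_o a.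
Proof.
move=> S0; rewrite lt_neqAle a_o_ge0 andbT; apply: contraTneq S0 => a0.
rewrite -leNgt S_sumE big1 // => i _; rewrite big1 // => j ij.
have := a_cent_le ij; rewrite -a0 normr_le0 a_centE => /eqP ->.
by rewrite expr0n.
Qed.

Variables (p : {perm 'I_n} -> R) (kappa : R) (N : nat).
Hypothesis p0 : forall tau, 0 <= p tau.
Hypothesis p1 : Rsum p = 1.
Hypothesis pJ : forall tau s : {perm 'I_n}, p (tau ^ s)%g = p tau.
Hypothesis fpf : forall tau, p tau != 0 -> forall m, tau m != m.
Hypothesis local : forall tau, p tau != 0 -> forall k l (P := nbhd tau k l),
  (#|[set m | (m \in P) || (tau m \in P)]| + 2 * size P <= N)%N.
Hypothesis kappa0 : 0 <= kappa.
Hypothesis variance : forall tau, p tau != 0 -> forall b : 'I_n -> 'I_n -> R, centered b ->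
  \sum_s cost b tau s ^+ 2 = #|{perm 'I_n}|%:R * (kappa * \sum_x \sum_y b x y ^+ 2).

Lemma exp_Lipschitz (theta r x y : R) : 0 <= theta -> `|x - y| <= r ->
  exp (theta * x) <= exp (r * theta) * exp (theta * y).
Proof.
move=> th0 xy; rewrite expRD; apply/RleP; apply: exp_mono; apply/RleP.
rewrite !RmultE !RplusE (mulrC r) -mulrDr ler_wpM2l //.
by move: xy; rewrite ler_norml => /andP[_]; lra.
Qed.

Lemma zero_bias_recenter (b : 'I_n -> 'I_n -> R) theta :
  centered b -> (forall x y, `|b x y| <= a_o a) ->
  \sum_x \sum_y b x y ^+ 2 <= S_sum a -> (0 <= theta)%R ->
  Rle (Rsum (fun tau : {perm 'I_n} =>
        (p tau * ((\sum_i b i (tau i)) * exp (theta * (\sum_i b i (tau i)))))%R))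
   (kappa * S_sum a * theta * exp (2 * a_o a * N%:R * theta)
    * Rsum (fun tau : {perm 'I_n} => p tau * exp (theta * (\sum_i b i (tau i)))))%R.
Proof.
move=> bc bb bS th0; apply/RleP; rewrite !RsumE.
apply: (zero_bias_ineq_mixture (f := fun x => exp (theta * x)) (ltnW (ltnW (ltnW n5)))
  bc a_o_ge0 bb p0 pJ _ th0).
- move=> tau ptau; split; [exact: fpf|exact: local|].
  by rewrite variance // ler_wpM2l ?ler0n // ler_wpM2l.
- exact/RleP/Rlt_le/exp_pos.
- by move=> x; apply/RleP/Rlt_le/exp_pos.
- by move=> x y; rewrite -RpowE; apply/RleP/exp_slope_le/RleP.
- by move=> x y; apply: exp_Lipschitz.
Qed.

Let b := recenter a (a_io a) (a_oo a).
Let n4 : (4 <= n)%N. Proof. exact: ltnW. Qed.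

Lemma sum_recenterE (tau : {perm 'I_n}) : p tau != 0 -> \sum_i b i (tau i) = Yval a tau - mu a.
Proof.
by move=> /fpf tau_fpf; rewrite (sum_recenter _ a_ooE) // muE /Yval RsumE.
Qed.

(** The two events may differ off the support of [p], but there both branches of the conditional are
    0. *)
Lemma P_upperE t :
  P_upper a p t = Rsum (fun tau : {perm 'I_n} =>
    if Rle_dec t (\sum_i b i (tau i)) then p tau else IZR 0).
Proof.
apply: Rsum_ext => tau; have [->|/sum_recenterE ->//] := eqVneq (p tau) 0.
by case: Rle_dec => ?; case: Rle_dec.
Qed.

Lemma P_lowerE t :
  P_lower a p t = Rsum (fun tau : {perm 'I_n} =>
    if Rle_dec t (\sum_i - b i (tau i)) then p tau else IZR 0).
Proof.
apply: Rsum_ext => tau; have [->|ptau] := eqVneq (p tau) 0.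
  by case: Rle_dec => ?; case: Rle_dec.
rewrite sumrN sum_recenterE //.
case: Rle_dec => H1; case: Rle_dec => H2 //=; exfalso.
  by apply: H2; apply/RleP; rewrite lerNr; apply/RleP.
by apply: H1; apply/RleP; rewrite lerNr; apply/RleP.
Qed.

Lemma Expect_Yval : Expect p (Yval a) = mu a.
Proof.
rewrite /Expect RsumE.
have E : \sum_tau p tau * (Yval a tau - mu a) = 0.
  transitivity (\sum_tau p tau * \sum_i b i (tau i)); last first.
    apply: sum_perm_cost_eq0 pJ fpf; first exact: leq_trans n5.
    exact: (centered_recenter n4 aC a_ioE a_ooE).
  apply: eq_bigr => tau _.
  have [->|/sum_recenterE -> //] := eqVneq (p tau) 0; by rewrite !mul0r.
move: E; under eq_bigr => tau _ do rewrite mulrBr.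
rewrite sumrB -mulr_suml -[\sum_tau p tau]RsumE p1 mul1r.
by move/eqP; rewrite subr_eq0 => /eqP.
Qed.

Local Open Scope R_scope.

Lemma concentration (sigma2 c : R) : (0 < N)%N ->
  sigma2 = kappa * S_sum a -> c = 2 * a_o a * INR N -> 0 < sigma2 ->
  Expect p (Yval a) = mu a /\
  (forall t, 0 <= t ->
     Rmax (P_upper a p t) (P_lower a p t)
       <= exp (- (t ^ 2 / (2 * (sigma2 + c * t)))) /\
     Rmax (P_upper a p t) (P_lower a p t)
       <= exp (- (t ^ 2 / (10 * sigma2 / 3 + c * t)))) /\
  (forall t, exp 1 < t ->
     Rmax (P_upper a p t) (P_lower a p t)
       <= exp (- (t / c * (ln t - ln (ln t) - sigma2 / c))) /\
     exp (- (t / c * (ln t - ln (ln t) - sigma2 / c)))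
       <= exp (- (t / (2 * c) * (ln t - 2 * sigma2 / c)))).
Proof.
move=> N0 s2E cE s0.
have c0 : 0 < c.
  rewrite cE; apply: Rmult_lt_0_compat; last exact/lt_0_INR/ssrnat.ltP.
  apply: Rmult_lt_0_compat; first by Lra.lra.
  apply/RltP/a_o_gt0; rewrite lt_neqAle eq_sym; apply/andP; split.
    by apply/eqP => S0; move: s0; rewrite s2E S0 Rmult_0_r; apply: Rlt_irrefl.
  by rewrite S_sumE sumr_ge0 // => i _; rewrite sumr_ge0 // => j _; rewrite sqr_ge0.
have bc : centered b by exact: (centered_recenter n4 aC a_ioE a_ooE).
have bb x y : (`|b x y| <= a_o a)%R.
  by apply: (norm_recenter_le aC x y a_o_ge0) => i j; apply: a_cent_le.
have bS : (\sum_x \sum_y b x y ^+ 2 <= S_sum a)%R.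
  by rewrite S_sumE; exact: sum_recenter_sq_le.
have p0' tau : 0 <= p tau by apply/RleP.
(* Stated for an arbitrary array so that it serves both [b] and its negative, hence both tails. *)
have zb b' : centered b' -> (forall x y, `|b' x y| <= a_o a)%R ->
    (\sum_x \sum_y b' x y ^+ 2 <= S_sum a)%R -> forall theta, 0 <= theta ->
    Rsum (fun tau : {perm 'I_n} =>
      p tau * ((\sum_i b' i (tau i))%R * exp (theta * (\sum_i b' i (tau i))%R)))
    <= sigma2 * theta * exp (c * theta)
       * Rsum (fun tau : {perm 'I_n} => p tau * exp (theta * (\sum_i b' i (tau i))%R)).
  move=> cb' bb' bS' theta /RleP th0; rewrite s2E cE INRE.
  exact: zero_bias_recenter.
have zb1 := zb _ bc bb bS.
have bbN x y : (`|- b x y| <= a_o a)%R by rewrite normrN.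
have bSN : (\sum_x \sum_y (- b x y) ^+ 2 <= S_sum a)%R.
  by under eq_bigr => x _ do under eq_bigr => y _ do rewrite sqrrN.
have zb2 := zb _ (centeredN bc) bbN bSN.
split; first exact: Expect_Yval.
split=> t t0; rewrite P_upperE P_lowerE; split.
- by apply: Rmax_lub; apply: tail_bernstein.
- by apply: Rmax_lub; apply: tail_bernstein'.
- by apply: Rmax_lub; apply: tail_poisson.
- exact: poisson_exponent_le.
Qed.


End Bridge.

(** * Conjugation invariance of the two laws *)

Lemma ncycles_conj (n : nat) (tau s : {perm 'I_n}) q : ncycles (tau ^ s)%g q = ncycles tau q.
Proof.
rewrite /ncycles porbits_conj.
have sI : injective (fun C : {set 'I_n} => s @: C) := imset_inj (@perm_inj _ s).
rewrite -[RHS](card_imset _ sI); apply: eq_card => C.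
rewrite inE; apply/idP/idP => [/andP[/imsetP[D Dt ->]]|/imsetP[D]].
  by rewrite card_imset; [move=> Dq; apply: imset_f; rewrite inE Dt | exact: perm_inj].
rewrite inE => /andP[Dt Dq] ->; rewrite imset_f //= card_imset //; exact: perm_inj.
Qed.

Lemma fpf_involution_conj (n : nat) (tau s : {perm 'I_n}) :
  fpf_involution (tau ^ s)%g = fpf_involution tau.
Proof.
apply/forallP/forallP => H i.
  by have := H (s i); rewrite !permJ !(inj_eq perm_inj).
by rewrite -(permKV s i) !permJ !(inj_eq perm_inj).
Qed.

Local Open Scope R_scope.

Theorem theorem3p2 (n : nat) (a : 'I_n -> 'I_n -> R)
  (p : {perm 'I_n} -> R) (sigma2 c : R) :
  (5 <= n)%N ->
  (forall i j, a i j = a j i) ->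
  is_distribution p ->
  ( (~~ odd n /\ uniform_fpf_involution p /\
     sigma2 = 2 * (INR n - 2) / ((INR n - 1) * (INR n - 3)) * S_sum a /\
     c = 24 * a_o a)
  \/
    (cycle_type_constant_no_fix_no_2 p /\
     sigma2 = / (INR n - 1) * S_sum a /\
     c = 40 * a_o a) ) ->
  0 < sigma2 ->
  Expect p (Yval a) = mu a /\
  (forall t, 0 <= t ->
     Rmax (P_upper a p t) (P_lower a p t)
       <= exp (- (t ^ 2 / (2 * (sigma2 + c * t)))) /\
     Rmax (P_upper a p t) (P_lower a p t)
       <= exp (- (t ^ 2 / (10 * sigma2 / 3 + c * t)))) /\
  (forall t, exp 1 < t ->
     Rmax (P_upper a p t) (P_lower a p t)
       <= exp (- (t / c * (ln t - ln (ln t) - sigma2 / c))) /\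
     exp (- (t / c * (ln t - ln (ln t) - sigma2 / c)))
       <= exp (- (t / (2 * c) * (ln t - 2 * sigma2 / c)))).
Proof.
move=> n5 aC [p0 p1] cases s0.
have n5R : (5 <= n%:R :> R)%R by rewrite ler_nat.
have n4 : (4 <= n)%N := ltnW n5.
have p0' tau : (0 <= p tau)%R by apply/RleP.
case: cases => [[_ [unif [s2E cE]]]|[[pct pno] [s2E cE]]].
- have supp tau : p tau != 0%R -> forall m, tau (tau m) = m /\ tau m != m.
    rewrite unif; case: ifP => [/forallP H _ m|]; last by rewrite eqxx.
    by have /andP[/eqP] := H m.
  have pJ (tau s : {perm 'I_n}) : p (tau ^ s)%g = p tau.
    by rewrite !unif fpf_involution_conj.
  (* [N = 12]: at most 4 summands meet the neighbourhood, and at most 4 forced values disturb 2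
     each. Hence [c = 2 * a_o a * 12]. *)
  apply: (@concentration n a n5 aC p (2 * (n%:R - 2) / ((n%:R - 1) * (n%:R - 3)))%R 12) => //.
  + by move=> tau /supp H m; case: (H m).
  + move=> tau /supp H k l; set P := nbhd tau k l; have inv m : tau (tau m) = m by case: (H m).
    have s4 : (2 * size P <= 8)%N by exact: leq_mul (leqnn 2) (size_nbhd_involution k l inv).
    exact: leq_add (card_nbhd_involution k l inv) s4.
  + by rewrite divr_ge0 // mulr_ge0 //; lra.
  + move=> tau /supp H b bc.
    have inv m : tau (tau m) = m by case: (H m).
    have fpf m : tau m != m by case: (H m).
    exact: sum_cost_sq_involution.
  + by rewrite s2E INRE.
  + by rewrite cE /INR; Lra.lra.
- have supp tau : p tau != 0%R -> no_fix_no_2cycle tau by move=> /eqP; apply: pno.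
  have pJ (tau s : {perm 'I_n}) : p (tau ^ s)%g = p tau.
    by apply: pct => q; apply: ncycles_conj.
  (* [N = 20]: at most 8 summands meet the neighbourhood, and at most 6 forced values disturb 2
     each. *)
  apply: (@concentration n a n5 aC p (n%:R - 1)^-1%R 20) => //.
  + by move=> tau /supp H m; apply/eqP; case: (H m).
  + move=> tau _ k l; set P := nbhd tau k l.
    have s6 : (2 * size P <= 12)%N by exact: leq_mul (leqnn 2) (size_nbhd tau k l).
    exact: leq_add (card_nbhd tau k l) s6.
  + by rewrite invr_ge0; lra.
  + move=> tau /supp H b bc.
    have fpf m : tau m != m by apply/eqP; case: (H m).
    have no2 m : tau (tau m) != m by apply/eqP; case: (H m).
    exact: sum_cost_sq_no2.
  + by rewrite s2E INRE.
  + by rewrite cE /INR; Lra.lra.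
Qed.
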